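(* Let $(\Omega,\mu)$ be a measure space, where $\mu$ is a $\sigma$-finite positive measure, let $H$ be a separable Hilbert space, $\{H_\omega\}_{\omega\in\Omega}$ a family of Hilbert spaces, and $K\in B(H)$. Suppose that $\{\Lambda_\omega\in B(H,H_\omega):\omega\in\Omega\}$ is a family of operators such that $\{\Lambda_\omega f\}_{\omega\in\Omega}$ is strongly measurable for each $f\in H$. Then $\{\Lambda_\omega\}_{\omega\in\Omega}$ is a c-K-g-frame for $H$ with respect to $\{H_\omega\}_{\omega\in\Omega}$ if and only if the operator $$T:\Big(\oplus_{\omega\in\Omega}H_\omega,\mu\Big)_{L^2}\longrightarrow H$$ weakly defined by $$\langle TF,g\rangle=\int_\Omega\langle\Lambda_\omega^*F(\omega),g\rangle\,d\mu(\omega),\quad F\in\Big(\oplus_{\omega\in\Omega}H_\omega,\mu\Big)_{L^2},\ g\in H,$$ is bounded and $R(K)\subseteq R(T)$.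
   Context: $B(H,H')$ denotes the bounded linear operators from $H$ to $H'$, $B(H)=B(H,H)$, and $R(U)$ denotes the range of an operator $U$. Let $\prod_{\omega\in\Omega}H_\omega=\{f:\Omega\to\cup_{\omega\in\Omega}H_\omega:\ f(\omega)\in H_\omega\}$. An element $F\in\prod_{\omega\in\Omega}H_\omega$ is strongly measurable if $F$, as a mapping of $\Omega$ to $\oplus_{\omega\in\Omega}H_\omega$ (each $H_\omega$ viewed as the $\omega$-th summand), is measurable. The space $\big(\oplus_{\omega\in\Omega}H_\omega,\mu\big)_{L^2}$ is the Hilbert space of all strongly measurable $F\in\prod_{\omega\in\Omega}H_\omega$ with $\int_\Omega\|F(\omega)\|^2d\mu(\omega)<\infty$, with inner product $\langle F,G\rangle=\int_\Omega\langle F(\omega),G(\omega)\rangle d\mu(\omega)$. For $K\in B(H)$, a family $\{\Lambda_\omega\in B(H,H_\omega):\omega\in\Omega\}$ is a c-K-g-frame (continuous K-g-frame) for $H$ with respect to $\{H_\omega\}_{\omega\in\Omega}$ if (i) for each $f\in H$, $\{\Lambda_\omega f\}_{\omega\in\Omega}$ is strongly measurable; (ii) there exist constants $0<A\le B<\infty$ such that $A\|K^*f\|^2\le\int_\Omega\|\Lambda_\omega f\|^2d\mu(\omega)\le B\|f\|^2$ for all $f\in H$. *)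

(* Defs.v *)
From HB Require Import structures.
From mathcomp Require Import all_boot all_order all_algebra.
From mathcomp Require Import sesquilinear.
From mathcomp Require Import complex.
From mathcomp Require Import all_classical all_reals all_analysis.

Set Implicit Arguments.
Unset Strict Implicit.
Unset Printing Implicit Defensive.

Import Order.TTheory GRing.Theory Num.Theory Num.Def.
Import numFieldNormedType.Exports.

Local Open Scope classical_set_scope.
Local Open Scope ring_scope.
Local Open Scope complex_scope.

(* Complex Hilbert spaces: the inner product is linear in its first argument
   and conjugate-linear in its second one, and induces the norm. *)
HB.mixin Record NormedModule_hasInner (R : realType) V
    of NormedModule R[i] V := {
  inner_form : {dot V for @conjC R[i]} ;
  inner_normE : forall x : V, inner_form x x = `|x| ^+ 2 }.

#[short(type="hilbertType")]
HB.structure Definition Hilbert (R : realType) :=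
  {V of CompleteNormedModule R[i] V & NormedModule_hasInner R V}.

Section Hilbert.
Context {R : realType}.

Definition inner {H : hilbertType R} (x y : H) : R[i] := inner_form x y.

(* The norm of a normed module over R[i] is R[i]-valued, with values in the
   nonnegative reals; hnorm is the same number in R. *)
Definition hnorm {H : hilbertType R} (x : H) : R := complex.Re `|x|.

Definition separable (H : hilbertType R) := exists2 D : set H, countable D & dense D.

Definition bounded_op {H H' : hilbertType R} (U : {linear H -> H'}) :=
  exists M : R, forall x, hnorm (U x) <= M * hnorm x.

(* When U is bounded, adjoint U y is the only z such that
   <U x, y> = <x, z> for all x. *)
Definition adjoint {H H' : hilbertType R} (U : H -> H') (y : H') : H :=
  get [set z : H | forall x, inner (U x) y = inner x z].

End Hilbert.

Section DirectSum.
Context {R : realType} {I : choiceType} (H : I -> hilbertType R).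
Implicit Types x y : forall i, H i.

(* The Hilbert space direct sum of the H i: the square-summable families. *)
Definition hsum : set (forall i, H i) :=
  [set x | (\esum_(i in setT) (hnorm (x i) ^+ 2)%:E < +oo)%E].

Definition hsum_norm x : R :=
  Num.sqrt (fine (\esum_(i in setT) (hnorm (x i) ^+ 2)%:E)).

Definition hsum_open (U : set (forall i, H i)) :=
  U `<=` hsum /\
  forall x, U x -> exists2 e : R, 0 < e &
    forall y, hsum y -> hsum_norm (fun i => y i - x i) < e -> U y.

(* v : H i viewed in the i-th summand *)
Definition hsum_inj (i : I) (v : H i) : forall j, H j :=
  dfwith (fun j => 0 : H j) i v.

End DirectSum.
Arguments hsum {R I} H _.
Arguments hsum_open {R I} H _.

Section ContinuousFrames.
Context {R : realType} {d : measure_display} {Omega : measurableType d}.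
Variables (mu : {measure set Omega -> \bar R}).

Definition Cintegrable (f : Omega -> R[i]) :=
  mu.-integrable setT (fun w => (complex.Re (f w))%:E) /\
  mu.-integrable setT (fun w => (complex.Im (f w))%:E).

Definition Cintegral (f : Omega -> R[i]) : R[i] :=
  Rintegral mu setT (fun w => complex.Re (f w)) +i*
  Rintegral mu setT (fun w => complex.Im (f w)).

Context {H : hilbertType R} {HO : Omega -> hilbertType R}.
Implicit Types F G : forall w, HO w.

(* Borel measurability of w |-> F w as a map from Omega to the direct sum *)
Definition strongly_measurable F :=
  forall B, <<s hsum HO, hsum_open HO >> B ->
    measurable [set w | B (hsum_inj (F w))].

(* The elements of L^2 are represented by functions; Ltwo_inner is positive
   semidefinite, and its null vectors are the F that vanish mu-almost
   everywhere. *)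
Definition Ltwo : set (forall w, HO w) :=
  [set F | strongly_measurable F /\
           (\int[mu]_w (hnorm (F w) ^+ 2)%:E < +oo)%E].

Definition Ltwo_inner F G : R[i] := Cintegral (fun w => inner (F w) (G w)).

Definition Ltwo_norm F : R := Num.sqrt (complex.Re (Ltwo_inner F F)).

(* Only the restriction of T to Ltwo matters. The estimate forces
   T F = T G when F = G mu-almost everywhere. *)
Definition bounded_Ltwo_op (T : (forall w, HO w) -> H) :=
  (forall (a : R[i]) F G, Ltwo F -> Ltwo G ->
     T (fun w => a *: F w + G w) = a *: T F + T G) /\
  exists M : R, forall F, Ltwo F -> hnorm (T F) <= M * Ltwo_norm F.

Variable Lambda : forall w, {linear H -> HO w}.

(* <T F, g> = \int <Lambda_w^* F(w), g> dmu(w), including the existence of the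
   integral *)
Definition weakly_defined (T : (forall w, HO w) -> H) :=
  forall F (g : H), Ltwo F ->
    Cintegrable (fun w => inner (adjoint (Lambda w) (F w)) g) /\
    inner (T F) g = Cintegral (fun w => inner (adjoint (Lambda w) (F w)) g).

Definition c_K_g_frame (K : {linear H -> H}) :=
  (forall f : H, strongly_measurable (fun w => Lambda w f)) /\
  exists A B : R, [/\ 0 < A, A <= B & forall f : H,
    ((A * hnorm (adjoint K f) ^+ 2)%:E
       <= \int[mu]_w (hnorm (Lambda w f) ^+ 2)%:E)%E /\
    (\int[mu]_w (hnorm (Lambda w f) ^+ 2)%:E
       <= (B * hnorm f ^+ 2)%:E)%E].

End ContinuousFrames.

(* Main.v *)
Require Import Defs.
From mathcomp Require Import all_boot all_order all_algebra.
From mathcomp Require Import sesquilinear complex.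
From mathcomp Require Import all_classical all_reals all_analysis.
From mathcomp Require Import measurable_realfun ring lra.

Set Implicit Arguments.
Unset Strict Implicit.
Unset Printing Implicit Defensive.

Import Order.TTheory GRing.Theory Num.Theory.
Import numFieldNormedType.Exports.

Local Open Scope classical_set_scope.
Local Open Scope ring_scope.
Local Open Scope complex_scope.

(** The family [Lambda] is an operator [f |-> (Lambda_w f)_w] from [H] to L^2,
the analysis operator, and [T] is its adjoint.  The upper frame bound says that
the analysis operator is bounded, hence that [T] is; the lower frame bound
[A |K^* f|^2 <= |T^* f|^2] is equivalent to the inclusion of the range of [K]
in that of [T] by the argument of Douglas' range inclusion theorem.

From the frame to [T]: for [F] in L^2 the form [g |-> <F, Lambda g>] is bounded
by the upper bound, and the Riesz theorem in [H] gives [T F]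
([synthesis_exists]).  For [y = K x] the lower bound says that
[Lambda g |-> <y, g>] is a bounded form on the range of the analysis operator,
so it is represented by some [F] in the closure of that range, and [T F = y]
([range_synthesis]).  Both representations come from one variational statement
about a positive semidefinite form on [H] ([riesz_sequence]); it produces a
Cauchy sequence, whose limit is taken in [H] or in L^2
([Ltwo_geometric_cvg]).

From [T] to the frame: pairing [T] with truncations of [Lambda f] to sets of
finite measure, where [Lambda f] is bounded, gives the upper bound in the limit
([bessel_of_bounded]); this is where sigma-finiteness enters.  For the lower
bound, writing [K x = T F] gives
[|<K^* f, x>| = |<Lambda f, F>| <= |Lambda f| |F|], so the set of the [K^* f]
with [|Lambda f| <= 1] is weakly bounded, hence bounded by the uniform
boundedness principle ([adjoint_le_of_range]).

That L^2 is a complete vector space relies on a peculiarity of strong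
measurability: the vectors of different summands of the direct sum are far
apart, so [F] is strongly measurable if and only if every subset of its
support is measurable ([strongly_measurableP]).  This property is visibly
inherited by linear combinations and pointwise limits.

Everything is done with the real part [rdot] of the inner product: it
determines the whole inner product ([innerE]), and a conjugate-linear statement
becomes a real-linear one. *)

(** * Real numbers *)

(** The discriminant argument behind every Cauchy-Schwarz inequality below;
the degenerate case [c = 0] is included because the forms to which it is
applied are only semidefinite. *)
Lemma discr_le (R : realFieldType) (a b c : R) :
  (forall t, 0 <= a + 2 * t * b + t ^+ 2 * c) -> b ^+ 2 <= a * c.
Proof.
move=> h; have a0 : 0 <= a by have := h 0; rewrite mulr0 mul0r expr0n mul0r !addr0.
have [c0|c0|c0] := ltgtP 0 c.
- have := h (- b / c); rewrite (_ : _ + _ = (a * c - b ^+ 2) / c).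
    by rewrite pmulr_lge0 ?invr_gt0// subr_ge0.
  by field; rewrite gt_eqF.
- have h2 t : 0 <= a + t ^+ 2 * c by have := h t; have := h (- t); rewrite sqrrN; lra.
  pose t := (a + 1) / (- c) + 1.
  have e : (t - 1) * (- c) = a + 1 by rewrite /t addrK divfK// oppr_eq0 lt_eqF.
  have t1 : 1 <= t by rewrite /t lerDr divr_ge0 ?oppr_ge0 1?ltW// ltr_wpDl.
  have := h2 t; nra.
- subst c; rewrite mulr0.
  have [->|b0] := eqVneq b 0; first by rewrite expr0n.
  have := h (- (a + 1) / (2 * b)); rewrite mulr0 addr0.
  rewrite (_ : _ + _ = -1); last by field.
  lra.
Qed.

Lemma geometric_lt (R : realType) (C q e : R) : 0 < q -> q < 1 -> 0 < e ->
  exists n, C * q ^+ n < e.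
Proof.
move=> q0 q1 e0.
have qc : C *: (q ^+ n) @[n --> \oo] --> C *: (0 : R^o).
  by apply: cvgZr; apply: cvg_expr; rewrite ger0_norm ?ltW.
rewrite scaler0 in qc.
have /cvgrPdist_lt/(_ e e0)[N _ /(_ N (leqnn N))] := qc.
by rewrite sub0r normrN => /(le_lt_trans (ler_norm _)) h; exists N.
Qed.

Lemma geometric_le0 (R : realType) (a C q : R) : 0 < q -> q < 1 ->
  (forall n, a <= C * q ^+ n) -> a <= 0.
Proof.
move=> q0 q1 h; rewrite leNgt; apply/negP => a0.
by have [n] := geometric_lt C q0 q1 a0; rewrite ltNge h.
Qed.

Lemma expr4V (R : realFieldType) n : (4^-1) ^+ n = ((2^-1) ^+ n) ^+ 2 :> R.
Proof.
by rewrite -exprM mulnC exprM; congr (_ ^+ _); rewrite expr2 -invfM -natrM.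
Qed.

(** * The real inner product of a Hilbert space *)

Section Hilbert.
Context {R : realType} {H : hilbertType R}.
Implicit Types (x y z : H) (t : R).

Definition rdot x y : R := complex.Re (inner x y).

Lemma rdotC x y : rdot x y = rdot y x.
Proof.
rewrite /rdot /inner (hermC (inner_form : {dot H for @Num.conj R[i]}) x y).
rewrite expr0 mul1r.
rewrite -[LHS]/(complex.Re (conjc (inner y x))) /inner.
by case: (inner_form y x).
Qed.

Lemma rdotDl x y z : rdot (x + y) z = rdot x z + rdot y z.
Proof. by rewrite /rdot /inner linearDl raddfD. Qed.

Lemma innerZl (a : R[i]) x y : inner (a *: x) y = a * inner x y.
Proof. by rewrite /inner linearZl. Qed.

Lemma innerZr (a : R[i]) x y : inner x (a *: y) = a^* * inner x y.
Proof. by rewrite /inner linearZr. Qed.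

Lemma rdotZl t x y : rdot (t%:C *: x) y = t * rdot x y.
Proof. by rewrite /rdot innerZl; case: (inner x y) => a b /=; rewrite mul0r subr0. Qed.

(** [inner] is conjugate-linear on the right, so multiplying the second argument
by ['i] brings the imaginary part to the real one. *)
Lemma innerE x y : inner x y = rdot x y +i* rdot x ('i *: y).
Proof.
by rewrite /rdot innerZr; case: (inner x y) => a b /=; congr (_ +i* _); ring.
Qed.

Lemma rdot_hnorm x : rdot x x = hnorm x ^+ 2.
Proof.
rewrite /rdot /inner /hnorm inner_normE.
have := normr_ge0 x; case: (`|x|) => a b; rewrite lecE/= => /andP[/eqP-> _].
by rewrite !expr2/= mulr0 subr0.
Qed.

Lemma norm_hnorm x : `|x| = (hnorm x)%:C.
Proof.
by have := normr_ge0 x; rewrite /hnorm; case: (`|x|) => a b; rewrite lecE/= => /andP[/eqP-> _].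
Qed.

Lemma rdot_ge0 x : 0 <= rdot x x.
Proof. by rewrite rdot_hnorm sqr_ge0. Qed.

Lemma hnorm_ge0 x : 0 <= hnorm x.
Proof. by have := normr_ge0 x; rewrite norm_hnorm lecR. Qed.

Lemma hnormD x y : hnorm (x + y) <= hnorm x + hnorm y.
Proof. by rewrite -lecR raddfD/= -!norm_hnorm ler_normD. Qed.

Lemma hnormN x : hnorm (- x) = hnorm x.
Proof. by rewrite /hnorm normrN. Qed.

Lemma hnormZC (a : R[i]) x : hnorm (a *: x) = complex.Re `|a| * hnorm x.
Proof. by rewrite /hnorm normrZ norm_hnorm normc_def /= mul0r subr0. Qed.

Lemma hnormZ t x : hnorm (t%:C *: x) = `|t| * hnorm x.
Proof. by rewrite hnormZC normc_def/= expr0n addr0 sqrtr_sqr. Qed.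

Lemma hnorm0 : hnorm (0 : H) = 0.
Proof. by rewrite /hnorm normr0. Qed.

Lemma hnorm_distC x y : hnorm (x - y) = hnorm (y - x).
Proof. by rewrite -hnormN opprB. Qed.

Lemma hnorm_eq0 x : hnorm x = 0 -> x = 0.
Proof. by move=> h; apply/normr0_eq0; rewrite norm_hnorm h. Qed.

Lemma rdot0l x : rdot 0 x = 0.
Proof. by have := rdotZl 0 0 x; rewrite scaler0 mul0r. Qed.

Lemma rdotNl x y : rdot (- x) y = - rdot x y.
Proof. by apply/eqP; rewrite -subr_eq0 opprK -rdotDl addNr rdot0l. Qed.

Lemma rdotBl x y z : rdot (x - y) z = rdot x z - rdot y z.
Proof. by rewrite rdotDl rdotNl. Qed.

Lemma rdotDr x y z : rdot x (y + z) = rdot x y + rdot x z.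
Proof. by rewrite !(rdotC x) rdotDl. Qed.

Lemma rdotZr t x y : rdot x (t%:C *: y) = t * rdot x y.
Proof. by rewrite !(rdotC x) rdotZl. Qed.

Lemma rdotZC (a : R[i]) x y : rdot (a *: x) y = rdot x (a^* *: y).
Proof.
rewrite /rdot innerZl innerZr; case: a => p q; case: (inner x y) => r s /=; ring.
Qed.

Lemma rdotZi x y : rdot ('i *: x) y = - rdot x ('i *: y).
Proof.
rewrite /rdot innerZl innerZr; case: (inner x y) => a b /=; ring.
Qed.

Lemma rdot_le x y : `|rdot x y| <= hnorm x * hnorm y.
Proof.
rewrite -(@ler_pXn2r _ 2) ?nnegrE ?mulr_ge0 ?hnorm_ge0//.
rewrite real_normK ?num_real// exprMn -!rdot_hnorm; apply: discr_le => t.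
have := rdot_ge0 (x + t%:C *: y).
rewrite !rdotDl !rdotDr !rdotZl !rdotZr (rdotC y x); congr (_ <= _); ring.
Qed.

Lemma rdotDD_le x y : rdot (x + y) (x + y) <= 2 * rdot x x + 2 * rdot y y.
Proof.
have := rdot_ge0 (x - y).
rewrite rdotBl !(rdotC _ (x - y)) !rdotBl rdotDl !rdotDr (rdotC y x).
lra.
Qed.

Lemma rdot_le_sum x y : `|rdot x y| <= rdot x x + rdot y y.
Proof.
apply: (le_trans (rdot_le x y)); rewrite !rdot_hnorm.
by have := sqr_ge0 (hnorm x - hnorm y); have := hnorm_ge0 x; have := hnorm_ge0 y; nra.
Qed.

Lemma rdot_inj x y : (forall z, rdot x z = rdot y z) -> x = y.
Proof.
move=> xy; apply/subr0_eq/hnorm_eq0/eqP; rewrite -sqrf_eq0 -rdot_hnorm.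
by rewrite rdotBl xy subrr.
Qed.

(** Completeness with an explicit rate: all the Cauchy sequences used below
converge geometrically. *)
Lemma geometric_cvg (u : nat -> H) (C q : R) : 0 < q -> q < 1 ->
  (forall n, hnorm (u n.+1 - u n) <= C * q ^+ n) ->
  exists l, forall n, hnorm (l - u n) <= C * q ^+ n / (1 - q).
Proof.
move=> q0 q1 hu.
have p0 : 0 < 1 - q by rewrite subr_gt0.
have C0 : 0 <= C by have := hu 0%N; rewrite expr0 mulr1; apply/le_trans/hnorm_ge0.
have bnd_ge0 n : 0 <= C * q ^+ n / (1 - q).
  by rewrite divr_ge0 ?mulr_ge0 ?exprn_ge0 // ltW.
have huk n k : hnorm (u (n + k)%N - u n) <= C * q ^+ n / (1 - q).
  suff : hnorm (u (n + k)%N - u n) <= C * q ^+ n / (1 - q) * (1 - q ^+ k).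
    move=> /le_trans; apply; rewrite ler_piMr// gerDl oppr_le0.
    by rewrite exprn_ge0 ?ltW.
  elim: k => [|k IH]; first by rewrite addn0 subrr hnorm0 expr0 subrr mulr0.
  have -> : u (n + k.+1)%N - u n = (u (n + k).+1 - u (n + k)%N) + (u (n + k)%N - u n).
    by rewrite addrA subrK addnS.
  apply: (le_trans (hnormD _ _)); apply: (le_trans (lerD (hu _) IH)).
  rewrite le_eqVlt; apply/orP; left; apply/eqP.
  by rewrite exprD exprS; field; rewrite gt_eqF.
have small e : 0 < e -> exists N, C * q ^+ N / (1 - q) < e.
  move=> e0; have [N hN] := geometric_lt (C / (1 - q)) q0 q1 e0.
  by exists N; rewrite mulrAC.
have ucv : cvg (u n @[n --> \oo]).
  apply/cauchy_cvgP/cauchyP => e e0.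
  have eE : e = (complex.Re e)%:C.
    by move: e0; case: (e) => a b; rewrite ltcE/= => /andP[/eqP-> _].
  have [|N hN] := small (complex.Re e); first by move: e0; rewrite eE ltcR.
  exists (u N); exists N => // m /= Nm.
  rewrite -ball_normE /ball_/= norm_hnorm eE ltcR hnorm_distC.
  by rewrite -(subnKC Nm); apply: le_lt_trans hN; exact: huk.
exists (lim (u n @[n --> \oo])) => n; apply/ler_addgt0Pr => e e0.
have e0' : (0 : R[i]) < e%:C by rewrite ltcR.
have /cvgrPdist_lt/(_ _ e0')[N _ hN] := ucv.
have := hN (n + N)%N (leq_addl _ _); rewrite /= norm_hnorm ltcR => h.
set l := lim _ in h *.
have -> : l - u n = (u (n + N)%N - u n) + (l - u (n + N)%N).
  by rewrite [RHS]addrC addrA subrK.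
by apply: (le_trans (hnormD _ _)); apply: lerD; [exact: huk | exact: ltW].
Qed.
End Hilbert.

(** * Representation of bounded forms *)

Section Variational.
Context {R : realType} {V : lmodType R[i]}.
Variables (b : V -> V -> R) (phi : V -> R) (C : R).
Hypotheses (bC : forall x y, b x y = b y x)
  (bD : forall x y z, b (x + y) z = b x z + b y z)
  (bZ : forall (t : R) x y, b (t%:C *: x) y = t * b x y)
  (b_ge0 : forall x, 0 <= b x x)
  (phiD : forall x y, phi (x + y) = phi x + phi y)
  (phiZ : forall (t : R) x, phi (t%:C *: x) = t * phi x)
  (phi_le : forall x, phi x ^+ 2 <= C * b x x)
  (C_ge0 : 0 <= C).

(** A minimizing sequence of the functional [J x = b x x - 2 phi x].  The
parallelogram identity makes it Cauchy for [b], and the fact that no direction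
[h] decreases [J] by more than [eps n] makes [b (g n)] close to [phi].  No
limit is taken, so that [b] may be the L^2 form pulled back to [H], for which
the limit lives in another space. *)
Lemma riesz_sequence (eps : nat -> R) : (forall n, 0 < eps n) ->
  exists g : nat -> V,
    (forall m n, b (g m - g n) (g m - g n) <= 2 * (eps m + eps n)) /\
    (forall n h, (b (g n) h - phi h) ^+ 2 <= eps n * b h h).
Proof.
move=> eps0.
have bDr x y z : b x (y + z) = b x y + b x z by rewrite !(bC x) bD.
have bZr t x y : b x (t%:C *: y) = t * b x y by rewrite !(bC x) bZ.
have NE (x : V) : - x = (-1)%:C *: x by
  rewrite -scaleN1r; congr (_ *: _); rewrite -[LHS]/((- 1) +i* (- 0)) oppr0.
pose J x := b x x - 2 * phi x.
(* b x x + C is at least 2 sqrt (C * b x x), hence at least 2 phi x *)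
have J_ge x : - C <= J x.
  rewrite leNgt; apply/negP; rewrite /J => h.
  have : (b x x + C) ^+ 2 < (2 * phi x) ^+ 2.
    have bx := b_ge0 x; have h3 : b x x + C < 2 * phi x by lra.
    by have C0 : 0 <= C := C_ge0; rewrite ltr_pXn2r // nnegrE; lra.
  have := phi_le x; have := sqr_ge0 (b x x - C); nra.
have Jinf : has_inf (range J).
  by split; [exists (J 0), 0 | exists (- C) => _ [x _ <-]].
have Jge x : inf (range J) <= J x by apply: ge_inf; [exact: Jinf.2 | exists x].
have /choice[g hg] n : exists x, J x <= inf (range J) + eps n.
  have [_ [x _ <-] /ltW] := inf_adherent (eps0 n) Jinf; by exists x.
exists g; split => [m n|n h].
  (* the midpoint does not do better than the infimum *)
  have := Jge ((2^-1)%:C *: (g m + g n)); have := hg m; have := hg n.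
  rewrite /J NE !(bD, bDr, bZ, bZr, phiZ, phiD) (bC (g n) (g m)).
  lra.
apply: discr_le => t; have := Jge (g n + t%:C *: h); have := hg n.
rewrite /J !(bD, bDr, bZ, bZr, phiZ, phiD) (bC h (g n)).
lra.
Qed.

End Variational.

Section HilbertRiesz.
Context {R : realType}.

Lemma riesz (H : hilbertType R) (phi : H -> R) (M : R) :
  (forall x y, phi (x + y) = phi x + phi y) ->
  (forall (t : R) x, phi (t%:C *: x) = t * phi x) ->
  (forall x, `|phi x| <= M * hnorm x) ->
  exists z, forall x, rdot x z = phi x.
Proof.
move=> phiD phiZ phiM.
have phi2 x : phi x ^+ 2 <= M ^+ 2 * rdot x x.
  rewrite rdot_hnorm -exprMn -real_normK ?num_real// ler_pXn2r ?nnegrE//.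
  exact: le_trans (phiM x).
(* since the norm is squared in J, the rate 4^-n gives convergence at rate 2^-n *)
have eps0 n : (0 : R) < (4^-1) ^+ n by rewrite exprn_gt0.
have [] := @riesz_sequence R H rdot phi (M ^+ 2) (@rdotC _ _) (@rdotDl _ _) (@rdotZl _ _)
  _ phiD phiZ phi2 (sqr_ge0 M) _ eps0.
  exact: rdot_ge0.
move=> g [gC gphi].
have p2 n : (0 : R) <= (2^-1) ^+ n by rewrite exprn_ge0.
have [||n|z hz] := @geometric_cvg R H g 2 2^-1.
- by rewrite invr_gt0.
- by rewrite invf_lt1// ltr1n.
- rewrite -(@ler_pXn2r _ 2) ?nnegrE ?mulr_ge0 ?hnorm_ge0//.
  rewrite -rdot_hnorm; apply: (le_trans (gC _ _)); rewrite exprMn -expr4V exprS.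
  by have := eps0 n; lra.
exists z => x; apply/eqP; rewrite -subr_eq0 -normr_le0.
apply: (@geometric_le0 R _ (5 * hnorm x) 2^-1) => //.
  by rewrite invf_lt1// ltr1n.
move=> n.
have h1 : `|rdot (g n) x - phi x| <= (2^-1) ^+ n * hnorm x.
  rewrite -(@ler_pXn2r _ 2) ?nnegrE ?mulr_ge0 ?hnorm_ge0//.
  by rewrite real_normK ?num_real// exprMn -expr4V -rdot_hnorm gphi.
have h2 : `|rdot (z - g n) x| <= 4 * (2^-1) ^+ n * hnorm x.
  apply: (le_trans (rdot_le _ _)); rewrite ler_wpM2r ?hnorm_ge0//.
  by apply: (le_trans (hz n)); rewrite le_eqVlt; apply/orP; left; apply/eqP; field.
rewrite (rdotC x) -(subrK (g n) z) rdotDl -addrA.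
apply: (le_trans (ler_normD _ _)); move: h1 h2; lra.
Qed.

(** The missing imaginary parts are obtained by replacing [x] with ['i x], which
the complex linearity of [U] allows. *)
Lemma rdot_innerP (H H' : hilbertType R) (U : {linear H -> H'}) y z :
  (forall x, rdot (U x) y = rdot x z) -> forall x, inner (U x) y = inner x z.
Proof.
move=> h x; rewrite !innerE h; congr (_ +i* _).
by apply: oppr_inj; rewrite -!rdotZi -linearZ h.
Qed.

Lemma adjointP (H H' : hilbertType R) (U : {linear H -> H'}) : bounded_op U ->
  forall x y, inner (U x) y = inner x (adjoint U y).
Proof.
move=> [M hM] x y.
have [|||z hz] := @riesz H (fun x => rdot (U x) y) (M * hnorm y).
- by move=> u v; rewrite linearD rdotDl.
- by move=> t u; rewrite linearZ rdotZl.
- move=> u; apply: (le_trans (rdot_le _ _)); rewrite mulrAC ler_wpM2r ?hnorm_ge0//.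
suff /getPex : exists z, forall x, inner (U x) y = inner x z by apply.
by exists z; apply: rdot_innerP.
Qed.

Lemma rdot_adjoint (H H' : hilbertType R) (U : {linear H -> H'}) : bounded_op U ->
  forall x y, rdot (adjoint U y) x = rdot y (U x).
Proof. by move=> bU x y; rewrite rdotC [RHS]rdotC /rdot adjointP. Qed.

Lemma adjointZ (H H' : hilbertType R) (U : {linear H -> H'}) (t : R) y :
  bounded_op U -> adjoint U (t%:C *: y) = t%:C *: adjoint U y.
Proof.
by move=> bU; apply: rdot_inj => z; rewrite rdotZl !rdot_adjoint// rdotZl.
Qed.

(** The uniform boundedness principle for the functionals [rdot s], by a gliding
hump.  If [S] is unbounded, a step of length [3^-n] along a long [s] in [S] (in
the direction that increases [|rdot s x|]) makes [|rdot s x|] at least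
[3^-n |s|]; all later steps together move [x] by at most half of [3^-n], so
that at the limit [|rdot s z| >= 3^-n |s| / 2], which is made larger than
[n]. *)
Lemma uniform_bounded_set (H : hilbertType R) (S : set H) :
  (forall x, exists M, forall s, S s -> `|rdot s x| <= M) ->
  exists M, forall s, S s -> hnorm s <= M.
Proof.
move=> hS; apply: contrapT => noM.
have big M : exists2 s, S s & M < hnorm s.
  apply: contrapT => h; apply: noM; exists M => s Ss; rewrite leNgt.
  by apply/negP => Ms; apply: h; exists s.
have r0 n : (0 : R) < (3^-1) ^+ n by rewrite exprn_gt0.
(* the length of s ensures that 3^-n |s| / 2 exceeds n *)
have stepP (p : nat * H) : exists y, hnorm (y - p.2) <= (3^-1) ^+ p.1 /\
    exists2 s, S s & 2 * 3 ^+ p.1 * p.1%:R < hnorm s /\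
      (3^-1) ^+ p.1 * hnorm s <= `|rdot s y|.
  case: p => n x /=.
  have [s Ss hs] := big (2 * 3 ^+ n * n%:R).
  have s0 : 0 < hnorm s.
    by apply: le_lt_trans hs; rewrite !mulr_ge0 ?exprn_ge0.
  pose t : R := (3^-1) ^+ n / hnorm s.
  have t0 : 0 <= t by rewrite divr_ge0// ltW.
  have ts : t * hnorm s = (3^-1) ^+ n by rewrite /t divfK// gt_eqF.
  have [a0|a0] := leP 0 (rdot s x).
    exists (x + t%:C *: s); split.
      by rewrite addrC addKr hnormZ ger0_norm// ts.
    exists s => //; split=> //; rewrite rdotDr rdotZr rdot_hnorm ger0_norm.
      by rewrite expr2 mulrA ts lerDr.
    by rewrite addr_ge0// mulr_ge0// sqr_ge0.
  exists (x + (- t)%:C *: s); split.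
    by rewrite addrC addKr hnormZ normrN ger0_norm// ts.
  exists s => //; split=> //; rewrite rdotDr rdotZr rdot_hnorm ler0_norm.
    by rewrite mulNr opprD opprK expr2 mulrA ts lerDr oppr_ge0 ltW.
  by rewrite mulNr subr_le0 (le_trans (ltW a0))// mulr_ge0// sqr_ge0.
have [step {}stepP] := choice stepP.
pose u := fix u n := if n is m.+1 then step (m, u m) else 0.
have [||n|z hz] := @geometric_cvg R H u 1 3^-1.
- by rewrite invr_gt0.
- by rewrite invf_lt1// ltr1n.
- by rewrite mul1r; exact: (stepP (n, u n)).1.
have [M hM] := hS z.
pose n := (Num.truncn `|M|).+1.
have [_ [s Ss [/= s_big s_u]]] := stepP (n, u n).
have tail : `|rdot s (z - u n.+1)| <= 2^-1 * (3^-1) ^+ n * hnorm s.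
  apply: (le_trans (rdot_le _ _)); rewrite mulrC ler_wpM2r ?hnorm_ge0//.
  apply: (le_trans (hz _)); rewrite mul1r exprS.
  by rewrite le_eqVlt; apply/orP; left; apply/eqP; field.
have zE : rdot s z = rdot s (u n.+1) + rdot s (z - u n.+1).
  by rewrite -rdotDr addrC subrK.
have := hM s Ss; apply/negP; rewrite -ltNge.
have h1 : 2^-1 * (3^-1) ^+ n * hnorm s <= `|rdot s z|.
  have := lerB_normD (rdot s (u n.+1)) (rdot s (z - u n.+1)); rewrite -zE.
  move: tail s_u => /=; lra.
apply: (lt_le_trans _ h1); apply: (@lt_le_trans _ _ n%:R).
  by apply: (le_lt_trans (ler_norm _)); exact: truncnS_gt.
have -> : n%:R = 2^-1 * (3^-1) ^+ n * (2 * 3 ^+ n * n%:R) :> R.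
  by rewrite exprVn; field; rewrite expf_neq0// pnatr_eq0.
by rewrite ler_pM2l ?mulr_gt0 ?ltW.
Qed.
End HilbertRiesz.

(** * Strongly measurable fields *)

Section StrongMeasurability.
Context {R : realType} {d : measure_display} {Omega : measurableType d}.

(** Either [B] or its complement avoids [t0], and its preimage is then a subset
of the set where [g] differs from [t0]. *)
Lemma preimage_measurable (T : Type) (t0 : T) (g : Omega -> T) :
  (forall A, A `<=` [set w | g w <> t0] -> measurable A) ->
  forall B, measurable (g @^-1` B).
Proof.
move=> mg B.
have [Bt0|Bt0] := pselect (B t0); last by apply: mg => w /= Bw gw; apply: Bt0; rewrite -gw.
rewrite -(setCK (g @^-1` B)); apply: measurableC; apply: mg => w /= nBw gw.
by apply: nBw; rewrite gw.
Qed.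

Context {HO : Omega -> hilbertType R}.
Implicit Types F G : forall w, HO w.

Lemma hnorm_le_esum (x : forall w, HO w) w :
  ((hnorm (x w) ^+ 2)%:E <= \esum_(i in setT) (hnorm (x i) ^+ 2)%:E)%E.
Proof.
rewrite -(@esum_set1 R _ w (fun i => (hnorm (x i) ^+ 2)%:E)) ?lee_fin ?sqr_ge0//.
rewrite esum_mkcond; apply: le_esum => i _.
by case: ifP => // _; rewrite lee_fin sqr_ge0.
Qed.

Lemma hnorm_le_hsum_norm (x : forall w, HO w) w : hsum HO x ->
  hnorm (x w) <= hsum_norm x.
Proof.
move=> xfin; rewrite /hsum_norm -[leLHS]ger0_norm ?hnorm_ge0// -sqrtr_sqr.
rewrite ler_wsqrtr// -lee_fin fineK ?hnorm_le_esum// ge0_fin_numE//.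
by apply: esum_ge0 => i _; rewrite lee_fin sqr_ge0.
Qed.

Lemma hsum_inj_hsum w (v : HO w) : hsum HO (hsum_inj v).
Proof.
rewrite /hsum/= (_ : (fun i => _) = (fun i => if i \in [set w] then (hnorm v ^+ 2)%:E else 0%E)).
  by rewrite -esum_mkcond esum_set1 ?ltry// lee_fin sqr_ge0.
apply/funext => i; case: ifPn.
  by rewrite inE/= => ->; rewrite /hsum_inj dfwithin.
move=> /negP; rewrite inE/= => iw; rewrite /hsum_inj dfwithout ?hnorm0 ?expr0n//.
by apply/eqP => wi; apply: iw.
Qed.

Lemma hsumB (x y : forall w, HO w) : hsum HO x -> hsum HO y ->
  hsum HO (fun w => x w - y w).
Proof.
have sq0 (z : forall w, HO w) i : (0 <= (hnorm (z i) ^+ 2)%:E)%E by rewrite lee_fin sqr_ge0.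
rewrite /hsum/= => hx hy.
have : (\esum_(i in setT) ((hnorm (x i) ^+ 2)%:E + (hnorm (x i) ^+ 2)%:E +
    ((hnorm (y i) ^+ 2)%:E + (hnorm (y i) ^+ 2)%:E)) < +oo)%E.
  by rewrite !esumD// ?adde_ge0// ?lte_add_pinfty// => i _; rewrite adde_ge0.
apply: le_lt_trans; apply: le_esum => i _.
rewrite -!EFinD lee_fin -!rdot_hnorm.
have := rdotDD_le (x i) (- y i); rewrite [rdot (- y i) _]rdot_hnorm hnormN -rdot_hnorm.
lra.
Qed.

(** For [A] inside the support of [F], the points of the direct sum with a
nonzero coordinate at some [w] in [A] form an open set, and its preimage under
[F] is [A], because [F w] has no other nonzero coordinate than the one at
[w]. *)
Lemma strongly_measurableP F :
  strongly_measurable F <-> (forall A, A `<=` [set w | F w <> 0] -> measurable A).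
Proof.
split=> [mF A AF|mF B _].
  pose U := [set y | hsum HO y /\ exists2 w, A w & y w <> 0].
  have oU : hsum_open HO U.
    split=> [y []//|y [hy [w Aw yw]]]; exists (hnorm (y w)).
      by rewrite lt_neqAle hnorm_ge0 andbT eq_sym; apply/eqP => /hnorm_eq0.
    move=> z hz; rewrite ltNge => /negP zy; split=> //; exists w => // zw; apply: zy.
    rewrite -[leLHS]hnormN -[- y w]add0r -zw.
    by apply: hnorm_le_hsum_norm; exact: hsumB.
  have := mF U (@sub_sigma_algebra _ _ _ _ oU).
  congr measurable; apply/seteqP; split=> [w /= [_ [w' Aw']]|w Aw].
    have [->//|ww'] := eqVneq w w'.
    by rewrite /hsum_inj dfwithout.
  split; first exact: hsum_inj_hsum.
  by exists w => //; rewrite /hsum_inj dfwithin; exact: AF.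
apply: (@preimage_measurable _ (fun j => 0 : HO j) (fun w => hsum_inj (F w))) => A AF.
apply: mF => w /AF /= h Fw; apply: h; apply: functional_extensionality_dep => j.
rewrite Fw /hsum_inj; by have [<-|wj] := eqVneq w j; rewrite ?dfwithin ?dfwithout.
Qed.

End StrongMeasurability.

(** * The space of square-integrable fields *)

Section Ltwo.
Context {R : realType} {d : measure_display} {Omega : measurableType d}.
Variable mu : {measure set Omega -> \bar R}.
Context {HO : Omega -> hilbertType R}.
Implicit Types F G E : forall w, HO w.

Lemma measurable_rdot F G : strongly_measurable F ->
  measurable_fun setT (fun w => rdot (F w) (G w)).
Proof.
move=> /strongly_measurableP mF _ Y _; rewrite setTI.
apply: (@preimage_measurable _ _ R 0) => A AF; apply: mF => w /AF /= h Fw.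
by apply: h; rewrite Fw rdot0l.
Qed.

Lemma measurable_hnorm2 F : strongly_measurable F ->
  measurable_fun setT (fun w => (hnorm (F w) ^+ 2)%:E).
Proof.
move=> mF; apply/measurable_EFinP; apply: eq_measurable_fun (measurable_rdot F mF).
by move=> w _; rewrite rdot_hnorm.
Qed.

Lemma strongly_measurable_lin (a : R[i]) F G : strongly_measurable F ->
  strongly_measurable G -> strongly_measurable (fun w => a *: F w + G w).
Proof.
move=> /strongly_measurableP mF /strongly_measurableP mG.
apply/strongly_measurableP => A AFG.
have -> : A = (A `&` [set w | F w <> 0]) `|` (A `&` [set w | G w <> 0]).
  apply/seteqP; split=> [w Aw|w [[]|[]]//].
  have [Fw|] := pselect (F w <> 0); first by left.
  have [Gw|] := pselect (G w <> 0); first by right.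
  by move=> /contrapT Gw /contrapT Fw; case: (AFG w Aw); rewrite Fw Gw scaler0 addr0.
by apply: measurableU; [apply: mF | apply: mG] => w [].
Qed.

Lemma strongly_measurableB F G : strongly_measurable F ->
  strongly_measurable G -> strongly_measurable (fun w => F w - G w).
Proof.
move=> hF hG; have := strongly_measurable_lin (-1) hG hF.
by congr strongly_measurable; apply: functional_extensionality_dep => w; rewrite scaleN1r addrC.
Qed.

Lemma LtwoP F : Ltwo mu F <-> strongly_measurable F /\
  mu.-integrable setT (EFin \o (fun w => rdot (F w) (F w))).
Proof.
have E : (\int[mu]_w `|(rdot (F w) (F w))%:E| = \int[mu]_w (hnorm (F w) ^+ 2)%:E)%E.
  by apply: eq_integral => w _; rewrite /= ger0_norm ?rdot_ge0// rdot_hnorm.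
split=> [[mF fF]|[mF /integrableP[_ fF]]]; split => //; last by rewrite -E.
apply/integrableP; split; last by rewrite E.
by apply/measurable_EFinP; exact: measurable_rdot.
Qed.

Lemma Ltwo_lin (a : R[i]) F G : Ltwo mu F -> Ltwo mu G ->
  Ltwo mu (fun w => a *: F w + G w).
Proof.
move=> /LtwoP[mF iF] /LtwoP[mG iG]; apply/LtwoP.
have mL := strongly_measurable_lin a mF mG.
split => //.
pose c := 2 * complex.Re `|a| ^+ 2.
apply: (@le_integrable _ _ _ mu _ _ _ (EFin \o (fun w => c * rdot (F w) (F w) + 2 * rdot (G w) (G w)))) => //.
- by apply/measurable_EFinP; exact: measurable_rdot.
- move=> w _; rewrite /= lee_fin ger0_norm ?rdot_ge0// (le_trans _ (ler_norm _))//.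
  apply: (le_trans (rdotDD_le _ _)).
  by rewrite {1}rdot_hnorm hnormZC exprMn -rdot_hnorm /c mulrA.
- have := integrableD measurableT (integrableZl measurableT c iF) (integrableZl measurableT 2 iG).
  exact.
Qed.

Lemma Ltwo0 : Ltwo mu (fun w => 0 : HO w).
Proof.
split; first by apply/strongly_measurableP => A A0; rewrite (_ : A = set0)//;
  apply/seteqP; split=> // w /A0 /(_ erefl).
rewrite (eq_integral (cst 0%E)) ?integral0 ?ltry// => w _.
by rewrite hnorm0 expr0n.
Qed.

Lemma LtwoD F G : Ltwo mu F -> Ltwo mu G -> Ltwo mu (fun w => F w + G w).
Proof.
move=> hF hG; have := Ltwo_lin 1 hF hG.
by congr Ltwo; apply: functional_extensionality_dep => w; rewrite scale1r.
Qed.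

Lemma LtwoB F G : Ltwo mu F -> Ltwo mu G -> Ltwo mu (fun w => F w - G w).
Proof.
move=> hF hG; have := Ltwo_lin (-1) hG hF.
by congr Ltwo; apply: functional_extensionality_dep => w; rewrite scaleN1r addrC.
Qed.

Lemma integrable_rdot F G : Ltwo mu F -> Ltwo mu G ->
  mu.-integrable setT (EFin \o (fun w => rdot (F w) (G w))).
Proof.
move=> /LtwoP[mF iF] /LtwoP[mG iG].
apply: (@le_integrable _ _ _ mu _ _ _ (EFin \o (fun w => rdot (F w) (F w) + rdot (G w) (G w)))) => //.
- by apply/measurable_EFinP; exact: measurable_rdot.
- by move=> w _; rewrite /= lee_fin (le_trans _ (ler_norm _))// rdot_le_sum.
- exact: (integrableD measurableT iF iG).
Qed.

(** The real part of [Ltwo_inner]. *)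
Definition ldot F G : R := Rintegral mu setT (fun w => rdot (F w) (G w)).

Lemma Ltwo_normE F : Ltwo_norm mu F = Num.sqrt (ldot F F).
Proof. by []. Qed.

Lemma ldotC F G : ldot F G = ldot G F.
Proof. by apply: eq_Rintegral => w _; rewrite rdotC. Qed.

Lemma ldot_ge0 F : 0 <= ldot F F.
Proof. by apply: Rintegral_ge0 => w _; exact: rdot_ge0. Qed.

Lemma ldotDl F G E : Ltwo mu F -> Ltwo mu G -> Ltwo mu E ->
  ldot (fun w => F w + G w) E = ldot F E + ldot G E.
Proof.
move=> hF hG hE; rewrite /ldot -RintegralD//; [|exact: integrable_rdot..].
by apply: eq_Rintegral => w _; rewrite rdotDl.
Qed.

Lemma ldotZl (t : R) F E : Ltwo mu F -> Ltwo mu E ->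
  ldot (fun w => t%:C *: F w) E = t * ldot F E.
Proof.
move=> hF hE; rewrite /ldot -RintegralZl//; last exact: integrable_rdot.
by apply: eq_Rintegral => w _; rewrite rdotZl.
Qed.

Lemma LtwoZ (a : R[i]) F : Ltwo mu F -> Ltwo mu (fun w => a *: F w).
Proof.
move=> hF; have := Ltwo_lin a hF Ltwo0.
by congr Ltwo; apply: functional_extensionality_dep => w; rewrite addr0.
Qed.

Lemma ldotBl F G E : Ltwo mu F -> Ltwo mu G -> Ltwo mu E ->
  ldot (fun w => F w - G w) E = ldot F E - ldot G E.
Proof.
move=> hF hG hE; rewrite /ldot -RintegralB//; [|exact: integrable_rdot..].
by apply: eq_Rintegral => w _; rewrite rdotBl.
Qed.

Lemma ldot_le F G : Ltwo mu F -> Ltwo mu G ->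
  `|ldot F G| <= Ltwo_norm mu F * Ltwo_norm mu G.
Proof.
move=> hF hG; rewrite !Ltwo_normE -sqrtrM ?ldot_ge0// -[leLHS]sqrtr_sqr.
apply: ler_wsqrtr; apply: discr_le => t.
have htG := LtwoZ t%:C hG; have hFtG := LtwoD hF htG.
have := ldot_ge0 (fun w => F w + t%:C *: G w).
rewrite ldotDl// ldotZl// !(ldotC _ (fun w => F w + _)) !ldotDl// !ldotZl// (ldotC G F).
by congr (_ <= _); ring.
Qed.

Lemma int_hnorm F : Ltwo mu F ->
  (\int[mu]_w (hnorm (F w) ^+ 2)%:E)%E = (ldot F F)%:E.
Proof.
move=> hF; rewrite /ldot /Rintegral fineK.
  by apply: eq_integral => w _; rewrite rdot_hnorm.
exact: integrable_fin_num (integrable_rdot hF hF).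
Qed.

Lemma Ltwo_norm_sq F : Ltwo_norm mu F ^+ 2 = ldot F F.
Proof. by rewrite Ltwo_normE sqr_sqrtr// ldot_ge0. Qed.

(** Completeness of L^2.  With [S = \sum_n 4^n |u_(n+1) - u_n|^2] one has
[|u_(n+1) - u_n| <= sqrt S 2^-n] pointwise, so that where [S] is finite the
sequence converges and its distance to the limit is at most [2 sqrt S 2^-n].
As [S] is integrable, the square of this bound gives convergence in L^2.  The
bound holds trivially where [S] is infinite, which spares any discussion of
null sets. *)
Lemma Ltwo_geometric_cvg (u : nat -> forall w, HO w) (C : R) :
  (forall n, Ltwo mu (u n)) ->
  (forall n, ldot (fun w => u n.+1 w - u n w) (fun w => u n.+1 w - u n w)
     <= C * (8^-1) ^+ n) ->
  exists2 F, Ltwo mu F & exists D, forall n,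
    ldot (fun w => F w - u n w) (fun w => F w - u n w) <= D * (4^-1) ^+ n.
Proof.
move=> hu du.
pose a n w : R := 4 ^+ n * hnorm (u n.+1 w - u n w) ^+ 2.
pose S w : \bar R := (\sum_(n <oo) (a n w)%:E)%E.
have a_ge0 n w : 0 <= a n w by rewrite mulr_ge0 ?sqr_ge0 ?exprn_ge0.
have aE_ge0 n w : (0 <= (a n w)%:E)%E by rewrite lee_fin.
have S_ge0 w : (0 <= S w)%E by apply: nneseries_ge0.
have hdu n := LtwoB (hu n.+1) (hu n).
have ma n : measurable_fun setT (fun w => (a n w)%:E).
  under eq_fun do rewrite /a EFinM.
  by apply: measurable_funeM; exact: measurable_hnorm2 (hdu n).1.
have mS : measurable_fun setT S by apply: ge0_emeasurable_sum.
(* the series is dominated by C \sum_n 4^n 8^-n, whose partial sums are 2 C (1 - 2^-n) *)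
have intS : (\int[mu]_w S w < +oo)%E.
  rewrite integral_nneseries//.
  apply: (@le_lt_trans _ _ (2 * C)%:E); last exact: ltry.
  apply: lime_le.
    by apply: is_cvg_nneseries => n _ _; apply: integral_ge0.
  apply: nearW => n; apply: (@le_trans _ _ (2 * C * (1 - 2^-1 ^+ n))%:E).
    elim: n => [|n IH]; first by rewrite big_geq// expr0 subrr mulr0.
    rewrite big_nat_recr//=.
    have -> : 2 * C * (1 - 2^-1 ^+ n.+1) = 2 * C * (1 - 2^-1 ^+ n) + 4 ^+ n * (C * 8^-1 ^+ n).
      have -> : 8^-1 ^+ n = 4^-1 ^+ n * 2^-1 ^+ n :> R.
        by rewrite -exprMn; congr (_ ^+ _); field.
      have e1 : 4 ^+ n * 4^-1 ^+ n = 1 :> R by rewrite -exprMn divff ?expr1n.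
      have -> : 4 ^+ n * (C * (4^-1 ^+ n * 2^-1 ^+ n)) = (4 ^+ n * 4^-1 ^+ n) * (C * 2^-1 ^+ n) by ring.
      by rewrite e1 exprS; field.
    rewrite EFinD; apply: leeD => //.
    rewrite /a; under eq_integral do rewrite EFinM.
    rewrite ge0_integralZl//=; last 2 first.
    - exact: measurable_hnorm2 (hdu n).1.
    - by move=> w _; rewrite lee_fin sqr_ge0.
    by rewrite int_hnorm// -EFinM lee_fin ler_pM2l// exprn_gt0.
  rewrite lee_fin ler_piMr//.
    have := du 0%N; rewrite expr0 mulr1 => /(le_trans (ldot_ge0 _)) C0.
    by rewrite mulr_ge0.
(* the first condition keeps the support of the limit inside those of the u n *)
have lE w : exists l : HO w, ((forall n, u n w = 0) -> l = 0) /\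
  forall n, ((hnorm (l - u n w) ^+ 2)%:E <= (4 * (4^-1) ^+ n)%:E * S w)%E.
  have [Soo|Sfin] := eqVneq (S w) +oo%E.
    exists 0; split => // n; rewrite Soo gt0_muley ?leey// lte_fin.
  have SE : S w = (fine (S w))%:E.
    by rewrite fineK// ge0_fin_numE// lt_neqAle Sfin leey.
  have s0 : 0 <= fine (S w) by rewrite -lee_fin -SE.
  have p2 n : (0 : R) <= (2^-1) ^+ n by rewrite exprn_ge0.
  have [||n|l hl] := @geometric_cvg R _ (fun n => u n w) (Num.sqrt (fine (S w))) 2^-1.
  - by rewrite invr_gt0.
  - by rewrite invf_lt1// ltr1n.
  - rewrite -(@ler_pXn2r _ 2) ?nnegrE ?mulr_ge0 ?hnorm_ge0//.
    rewrite exprMn sqr_sqrtr// -expr4V exprVn ler_pdivlMr ?exprn_gt0// mulrC -/(a n w).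
    rewrite -lee_fin -SE; apply: le_trans (@nneseries_lim_ge _ _ _ 0%N n.+1 _) => //.
    by rewrite big_nat_recr//= leeDr// sume_ge0.
  exists l; split.
    move=> u0; have Sw0 : S w = 0%E.
      by rewrite /S eseries0// => n _ _; rewrite /a !u0 subr0 hnorm0 expr0n mulr0.
    have := hl 0%N; rewrite u0 subr0 Sw0 /= sqrtr0 !mul0r => l0.
    by apply: hnorm_eq0; apply/eqP; rewrite eq_le l0 hnorm_ge0.
  move=> n; rewrite SE -EFinM lee_fin.
  have -> : 4 * 4^-1 ^+ n * fine (S w) = (Num.sqrt (fine (S w)) * 2^-1 ^+ n / (1 - 2^-1)) ^+ 2.
    by rewrite !exprMn sqr_sqrtr// expr4V; field.
  by rewrite ler_pXn2r ?nnegrE ?hnorm_ge0// (le_trans _ (hl n))// hnorm_ge0.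
pose F w : HO w := sval (cid (lE w)).
have hF w := svalP (cid (lE w)); rewrite -/(F _) in hF.
have mF : strongly_measurable F.
  apply/strongly_measurableP => A AF.
  have -> : A = \bigcup_n (A `&` [set w | u n w <> 0]).
    apply/seteqP; split=> [w Aw|w [n _ []]//].
    apply: contrapT => h; apply: (AF w Aw); apply: (hF w).1 => n.
    by apply: contrapT => un; apply: h; exists n.
  by apply: bigcupT_measurable => n; apply: (strongly_measurableP _).1 (hu n).1 _ _ => w [].
have int_le n : (\int[mu]_w (hnorm (F w - u n w) ^+ 2)%:E <=
    (4 * (4^-1) ^+ n)%:E * \int[mu]_w S w)%E.
  have c0 : (0 <= 4 * (4^-1) ^+ n :> R) by rewrite mulr_ge0 ?exprn_ge0.
  rewrite -ge0_integralZl//=; apply: ge0_le_integral => //=.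
  - by move=> w _; rewrite lee_fin sqr_ge0.
  - exact: measurable_hnorm2 (strongly_measurableB mF (hu n).1).
  - exact: measurable_funeM.
  - by move=> w _; exact: (hF w).2.
have hFu n : Ltwo mu (fun w => F w - u n w).
  split; first exact: strongly_measurableB mF (hu n).1.
  apply: (le_lt_trans (int_le n)); rewrite lte_mul_pinfty//.
have hF2 : Ltwo mu F.
  have := LtwoD (hFu 0%N) (hu 0%N).
  by congr Ltwo; apply: functional_extensionality_dep => w; rewrite subrK.
exists F => //; exists (4 * fine (\int[mu]_w S w)%E) => n.
have Sf : (\int[mu]_w S w)%E \is a fin_num by rewrite ge0_fin_numE// integral_ge0.
have := int_le n; rewrite int_hnorm// -(fineK Sf) -EFinM lee_fin.
by rewrite mulrAC.
Qed.
End Ltwo.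

(** [G n] is [F] on the part of the [n]-th set of an exhaustion by sets of
finite measure where [|F| <= n], and zero elsewhere; the last property is
monotone convergence. *)
Lemma Ltwo_exhaustion {R : realType} {d : measure_display} {Omega : measurableType d}
    (mu : {sigma_finite_measure set Omega -> \bar R})
    {HO : Omega -> hilbertType R} (F : forall w, HO w) :
  strongly_measurable F ->
  exists G : nat -> forall w, HO w, [/\ forall n, Ltwo mu (G n),
    forall n w, rdot (G n w) (F w) = rdot (G n w) (G n w) &
    forall c : R, (forall n, ldot mu (G n) (G n) <= c) ->
      (\int[mu]_w (hnorm (F w) ^+ 2)%:E <= c%:E)%E].
Proof.
move=> mF.
have /sigma_finiteP[U [UT ndU mU]] := sigma_finiteT mu.
pose E n := U n `&` [set w | hnorm (F w) <= n%:R].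
pose G n w : HO w := if w \in E n then F w else 0.
have GF n w : w \in E n -> G n w = F w by rewrite /G => ->.
have G0 n w : w \notin E n -> G n w = 0 by rewrite /G => /negbTE->.
have mG n : strongly_measurable (G n).
  apply/strongly_measurableP => A AG; apply: (strongly_measurableP _).1 mF _ _.
  by move=> w /AG /= h Fw; apply: h; rewrite /G Fw; case: ifP.
have LG n : Ltwo mu (G n).
  split => //; apply: (@le_lt_trans _ _ (\int[mu]_w ((cst (n%:R ^+ 2)%:E) \_ (U n)) w)%E).
    apply: ge0_le_integral => //=.
    - by move=> w _; rewrite lee_fin sqr_ge0.
    - exact: measurable_hnorm2.
    - by apply/(measurable_restrictT _ _).1 => //; exact: (mU n).1.
    - move=> w _; rewrite patchE; have [wE|wE] := boolP (w \in E n); last first.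
        rewrite G0// hnorm0 expr0n; case: ifP => // _.
        by rewrite lee_fin sqr_ge0.
      move: (wE); rewrite inE => -[Uw Fw]; rewrite mem_set// GF// lee_fin.
      by rewrite ler_pXn2r ?nnegrE ?hnorm_ge0 ?ler0n.
  rewrite -integral_mkcond integral_cst; last exact: (mU n).1.
  by rewrite lte_mul_pinfty ?lee_fin ?sqr_ge0//; exact: (mU n).2.
exists G; split => //.
  move=> n w; have [wE|wE] := boolP (w \in E n); first by rewrite GF.
  by rewrite G0// rdot0l rdot0l.
move=> c Gc; pose g n w := (hnorm (G n w) ^+ 2)%:E.
have ndE n m w : (n <= m)%N -> w \in E n -> w \in E m.
  move=> nm; rewrite !inE => -[Uw Fw]; split.
    by have /subsetPset := ndU _ _ nm; exact.
  by apply: (le_trans Fw); rewrite ler_nat.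
have g_nd w : nondecreasing_seq (g ^~ w).
  move=> n m nm; rewrite /g; have [wE|wE] := boolP (w \in E n).
    by rewrite !GF// (ndE n).
  by rewrite G0// hnorm0 expr0n lee_fin sqr_ge0.
have g_lim w : limn (g ^~ w) = (hnorm (F w) ^+ 2)%:E.
  apply/cvg_lim => //; have [k _ Uk] : (\bigcup_i U i) w by rewrite -UT.
  apply: cvg_near_cst; near=> n; rewrite /g GF//.
  apply: (ndE (maxn k (Num.truncn (hnorm (F w))).+1)).
    by near: n; exact: nbhs_infty_ge.
  rewrite inE; split; first by have /subsetPset := ndU _ _ (leq_maxl k (Num.truncn (hnorm (F w))).+1); exact.
  by rewrite /=; apply/ltW/(lt_le_trans (truncnS_gt _)); rewrite ler_nat leq_maxr.
under eq_integral do rewrite -g_lim.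
rewrite monotone_convergence//.
- apply: lime_le.
    apply: ereal_nondecreasing_is_cvgn => n m nm.
    apply: ge0_le_integral => //.
    - by move=> w _; rewrite lee_fin sqr_ge0.
    - exact: measurable_hnorm2.
    - exact: measurable_hnorm2.
    - by move=> w _; exact: g_nd.
  by apply: nearW => n; rewrite int_hnorm// lee_fin.
- by move=> n; exact: measurable_hnorm2.
- by move=> n w _; rewrite lee_fin sqr_ge0.
Unshelve. all: by end_near. Qed.

(** * The synthesis operator *)

Section Synthesis.
Context {R : realType} {d : measure_display} {Omega : measurableType d}.
Variable mu : {measure set Omega -> \bar R}.
Context {H : hilbertType R} {HO : Omega -> hilbertType R}.
Variable Lambda : forall w, {linear H -> HO w}.
Hypothesis bLambda : forall w, bounded_op (Lambda w).
Implicit Types F G : forall w, HO w.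

(** The imaginary part of the defining identity of [T] at [g] is its real part
at ['i g]. *)
Lemma weakly_definedP (T : (forall w, HO w) -> H) :
  weakly_defined mu Lambda T <->
  forall F g, Ltwo mu F ->
    mu.-integrable setT (EFin \o (fun w => rdot (F w) (Lambda w g))) /\
    rdot (T F) g = ldot mu F (fun w => Lambda w g).
Proof.
have ReE F g : (fun w => complex.Re (inner (adjoint (Lambda w) (F w)) g)) =
    (fun w => rdot (F w) (Lambda w g)).
  by apply/funext => w; exact: rdot_adjoint.
have ImE F g : (fun w => complex.Im (inner (adjoint (Lambda w) (F w)) g)) =
    (fun w => rdot (F w) (Lambda w ('i *: g))).
  by apply/funext => w; rewrite innerE /= rdot_adjoint.
split=> hT F g hF.
  have [[iRe _]] := hT F g hF; rewrite /Cintegral ReE innerE => -[-> _]; split => //.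
  by have := iRe; rewrite -/(EFin \o (fun w => complex.Re _)) ReE.
have [iRe TRe] := hT F g hF; have [iIm TIm] := hT F ('i *: g) hF; split.
  split.
    by rewrite -/(EFin \o (fun w => complex.Re _)) ReE.
  by rewrite -/(EFin \o (fun w => complex.Im _)) ImE.
by rewrite /Cintegral ReE ImE innerE TRe TIm.
Qed.

Section Bessel.
Variable B : R.
Hypothesis mLambda : forall f, strongly_measurable (fun w => Lambda w f).
Hypothesis Lambda_le : forall f,
  (\int[mu]_w (hnorm (Lambda w f) ^+ 2)%:E <= (B * hnorm f ^+ 2)%:E)%E.

Lemma Ltwo_Lambda f : Ltwo mu (fun w => Lambda w f).
Proof. by split=> //; apply: le_lt_trans (Lambda_le f) _; rewrite ltry. Qed.
Local Hint Resolve Ltwo_Lambda : core.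

Lemma Ltwo_norm_Lambda f : Ltwo_norm mu (fun w => Lambda w f) <= Num.sqrt B * hnorm f.
Proof.
have := Lambda_le f; rewrite int_hnorm// lee_fin => h.
rewrite Ltwo_normE -[X in _ <= _ * X]ger0_norm ?hnorm_ge0// -sqrtr_sqr.
have [B0|B0] := leP 0 B; first by rewrite -sqrtrM// ler_wsqrtr.
rewrite [X in _ <= X * _](ler0_sqrtr (ltW B0)) mul0r ler0_sqrtr//.
by apply: (le_trans h); rewrite mulr_le0_ge0 ?sqr_ge0// ltW.
Qed.

Lemma synthesis_exists : exists T : (forall w, HO w) -> H,
  weakly_defined mu Lambda T /\ bounded_Ltwo_op mu T.
Proof.
have TP F : exists z, Ltwo mu F ->
    forall g, rdot z g = ldot mu F (fun w => Lambda w g).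
  have [hF|nF] := pselect (Ltwo mu F); last by exists 0.
  have [|||z hz] := @riesz R H (fun g => ldot mu F (fun w => Lambda w g))
      (Ltwo_norm mu F * Num.sqrt B).
  - move=> x y; rewrite !(ldotC mu F) -ldotDl//; congr (ldot mu _ F).
    by apply: functional_extensionality_dep => w; rewrite linearD.
  - move=> t x; rewrite !(ldotC mu F) -ldotZl//; congr (ldot mu _ F).
    by apply: functional_extensionality_dep => w; rewrite linearZ.
  - move=> x; apply: (le_trans (ldot_le hF _)) => //.
    by rewrite -mulrA ler_wpM2l ?sqrtr_ge0// Ltwo_norm_Lambda.
  by exists z => _ g; rewrite rdotC hz.
have [T hT] := choice TP.
exists T; split.
  by apply/weakly_definedP => F g hF; split; [exact: integrable_rdot|exact: hT].
split.
  move=> a F G hF hG; apply: rdot_inj => g; rewrite hT; last exact: Ltwo_lin.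
  rewrite rdotDl rdotZC !hT// ldotDl//; last exact: LtwoZ.
  congr (_ + _); apply: eq_Rintegral => w _.
  by rewrite rdotZC linearZ.
exists (Num.sqrt B) => F hF.
have [T0|T0] := eqVneq (hnorm (T F)) 0.
  by rewrite T0 mulr_ge0 ?sqrtr_ge0.
have Tpos : 0 < hnorm (T F) by rewrite lt_neqAle eq_sym T0 hnorm_ge0.
rewrite -(ler_pM2r Tpos) -expr2 -rdot_hnorm hT//.
apply: (le_trans (ler_norm _)); apply: (le_trans (ldot_le hF _)) => //.
by rewrite mulrC mulrAC ler_wpM2r ?sqrtr_ge0// Ltwo_norm_Lambda.
Qed.

(** The hypothesis says that [Lambda g |-> rdot y g] is well defined and bounded
for the L^2 norm.  [riesz_sequence], applied to the L^2 form pulled back to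
[H], gives fields [Lambda (g n)] that approximately represent it, and their L^2
limit represents it exactly. *)
Lemma range_synthesis (T : (forall w, HO w) -> H) (y : H) (C : R) :
  weakly_defined mu Lambda T ->
  (forall g, rdot y g ^+ 2 <= C * ldot mu (fun w => Lambda w g) (fun w => Lambda w g)) ->
  0 <= C -> (T @` Ltwo mu) y.
Proof.
move=> /weakly_definedP hT yC C0.
pose b g h := ldot mu (fun w => Lambda w g) (fun w => Lambda w h).
have LD f g : (fun w => Lambda w (f + g)) = (fun w => Lambda w f + Lambda w g).
  by apply: functional_extensionality_dep => w; rewrite linearD.
have LZ a f : (fun w => Lambda w (a *: f)) = (fun w => a *: Lambda w f).
  by apply: functional_extensionality_dep => w; rewrite linearZ.
have LB f g : (fun w => Lambda w (f - g)) = (fun w => Lambda w f - Lambda w g).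
  by apply: functional_extensionality_dep => w; rewrite linearB.
(* 8^-n is the rate that Ltwo_geometric_cvg asks for *)
have eps0 n : (0 : R) < (8^-1) ^+ n by rewrite exprn_gt0// invr_gt0.
have [] := @riesz_sequence R H b (rdot y) C _ _ _ _ _ _ yC C0 _ eps0.
- by move=> f g; rewrite /b ldotC.
- by move=> f g h; rewrite /b LD ldotDl.
- by move=> t f g; rewrite /b LZ ldotZl.
- by move=> f; exact: ldot_ge0.
- by move=> f g; exact: rdotDr.
- by move=> t f; exact: rdotZr.
move=> g [gC gy].
have [|n|F hF [D hD]] := @Ltwo_geometric_cvg _ _ _ mu HO (fun n w => Lambda w (g n)) 4.
- by [].
- rewrite -LB; apply: (le_trans (gC _ _)); rewrite exprS.
  have := eps0 n; lra.
exists F => //; apply: rdot_inj => h; rewrite (hT F h hF).2.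
apply/eqP; rewrite -subr_eq0 -normr_le0.
pose N := Ltwo_norm mu (fun w => Lambda w h).
have N0 : 0 <= N by exact: sqrtr_ge0.
apply: (@geometric_le0 R _ ((Num.sqrt D + 1) * N) 2^-1).
- by rewrite invr_gt0.
- by rewrite invf_lt1// ltr1n.
move=> n.
have p2 : (0 : R) <= (2^-1) ^+ n by rewrite exprn_ge0.
have h1 : `|b (g n) h - rdot y h| <= (2^-1) ^+ n * N.
  rewrite -(@ler_pXn2r _ 2) ?nnegrE ?mulr_ge0//.
  rewrite real_normK ?num_real//; apply: (le_trans (gy n h)).
  rewrite exprMn Ltwo_norm_sq ler_wpM2r ?ldot_ge0// -exprM mulnC exprM.
  by rewrite lerXn2r ?nnegrE// exprVn lef_pV2 ?posrE// -natrX ler_nat.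
have h2 : `|ldot mu (fun w => F w - Lambda w (g n)) (fun w => Lambda w h)| <=
    (2^-1) ^+ n * Num.sqrt D * N.
  apply: (le_trans (ldot_le (LtwoB hF (Ltwo_Lambda _)) (Ltwo_Lambda h))).
  rewrite ler_wpM2r// Ltwo_normE; apply: (le_trans (ler_wsqrtr (hD n))).
  rewrite mulrC sqrtrM ?exprn_ge0//.
  by rewrite expr4V sqrtr_sqr ger0_norm.
have -> : ldot mu F (fun w => Lambda w h) - rdot y h =
    ldot mu (fun w => F w - Lambda w (g n)) (fun w => Lambda w h) + (b (g n) h - rdot y h).
  by rewrite ldotBl// /b addrA subrK.
by apply: (le_trans (ler_normD _ _)); move: h1 h2; lra.
Qed.
End Bessel.

End Synthesis.

(** * The frame bounds *)

(** For a truncation [G] of [Lambda f], the number [N = |G|] satisfies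
[N^2 = <G, Lambda f> = <T G, f> <= M N |f|], so [N <= M |f|] uniformly in the
truncation. *)
Lemma bessel_of_bounded {R : realType} {d : measure_display} {Omega : measurableType d}
    (mu : {sigma_finite_measure set Omega -> \bar R})
    {H : hilbertType R} {HO : Omega -> hilbertType R}
    (Lambda : forall w, {linear H -> HO w}) (T : (forall w, HO w) -> H) (M : R) :
  (forall w, bounded_op (Lambda w)) ->
  (forall f, strongly_measurable (fun w => Lambda w f)) ->
  weakly_defined mu Lambda T ->
  (forall F, Ltwo mu F -> hnorm (T F) <= M * Ltwo_norm mu F) ->
  forall f, (\int[mu]_w (hnorm (Lambda w f) ^+ 2)%:E <= (M ^+ 2 * hnorm f ^+ 2)%:E)%E.
Proof.
move=> bL mL /(weakly_definedP mu bL) wT bT f.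
have [G [LG GL]] := Ltwo_exhaustion mu (mL f); apply => n.
have GE : ldot mu (G n) (fun w => Lambda w f) = ldot mu (G n) (G n).
  by apply: eq_Rintegral => w _; exact: GL.
have := (wT _ f (LG n)).2; rewrite GE => TG.
pose N := Ltwo_norm mu (G n); have N0 : 0 <= N by exact: sqrtr_ge0.
have NE : ldot mu (G n) (G n) = N ^+ 2 by rewrite Ltwo_norm_sq.
have N2 : N ^+ 2 <= (M * hnorm f) * N.
  rewrite -NE -TG; apply: (le_trans (ler_norm _)); apply: (le_trans (rdot_le _ _)).
  by rewrite mulrAC ler_wpM2r ?hnorm_ge0// bT.
rewrite NE -exprMn; have [->|Npos] := eqVneq N 0; first by rewrite expr0n sqr_ge0.
have {}Npos : 0 < N by rewrite lt_neqAle eq_sym Npos.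
have NM : N <= M * hnorm f by rewrite -(ler_pM2r Npos) -expr2.
by rewrite ler_pXn2r// nnegrE (le_trans _ NM).
Qed.

Section LowerBound.
Context {R : realType} {d : measure_display} {Omega : measurableType d}.
Variable mu : {measure set Omega -> \bar R}.
Context {H : hilbertType R} {HO : Omega -> hilbertType R}.
Variable Lambda : forall w, {linear H -> HO w}.
Hypothesis bLambda : forall w, bounded_op (Lambda w).

(** The [K^* f] with [|Lambda f| <= 1] form a weakly bounded set, since
[K x = T F] yields [<K^* f, x> = <f, T F> = <Lambda f, F>].  A uniform bound on
this set extends to all [f] by homogeneity. *)
Lemma adjoint_le_of_range (K : {linear H -> H}) (T : (forall w, HO w) -> H) :
  bounded_op K -> (forall f, Ltwo mu (fun w => Lambda w f)) ->
  weakly_defined mu Lambda T -> range K `<=` T @` Ltwo mu ->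
  exists2 C : R, 0 < C & forall f,
    hnorm (adjoint K f) <= C * Ltwo_norm mu (fun w => Lambda w f).
Proof.
move=> bK LL /(weakly_definedP mu bLambda) wT KT.
pose N f := Ltwo_norm mu (fun w => Lambda w f).
have N0 f : 0 <= N f by exact: sqrtr_ge0.
pose S := [set s | exists2 f, s = adjoint K f & N f <= 1].
have [|M hM] := @uniform_bounded_set R H S.
  move=> x; have [F hF TF] : (T @` Ltwo mu) (K x) by apply: KT; exists x.
  exists (Ltwo_norm mu F) => _ [f -> Nf].
  rewrite rdot_adjoint// -TF rdotC (wT F f hF).2.
  apply: (le_trans (ldot_le hF (LL f))).
  by rewrite -[leRHS]mulr1 ler_wpM2l// sqrtr_ge0.
exists (`|M| + 1); first by rewrite ltr_wpDl.
move=> f; apply/ler_addgt0Pr => e e0.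
have C0 : 0 < `|M| + 1 by rewrite ltr_wpDl.
(* N f may vanish, so f is scaled by a number slightly larger than N f *)
pose r := N f + e / (`|M| + 1).
have r0 : 0 < r by rewrite ltr_wpDl// divr_gt0.
have NZ t : N (t%:C *: f) = `|t| * N f.
  rewrite /N !Ltwo_normE.
  have -> : (fun w => Lambda w (t%:C *: f)) = (fun w => t%:C *: Lambda w f).
    by apply: functional_extensionality_dep => w; rewrite linearZ.
  rewrite ldotZl//; last exact: LtwoZ.
  rewrite ldotC ldotZl// mulrA -expr2 sqrtrM ?sqr_ge0//.
  by rewrite sqrtr_sqr.
have : hnorm (adjoint K ((r^-1)%:C *: f)) <= M.
  apply: hM; exists ((r^-1)%:C *: f) => //.
  rewrite NZ gtr0_norm ?invr_gt0// ler_pdivrMl// mulr1.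
  by rewrite lerDl ltW// divr_gt0.
rewrite adjointZ// hnormZ gtr0_norm ?invr_gt0// ler_pdivrMl// => h.
apply: (le_trans h); apply: (@le_trans _ _ (r * (`|M| + 1))).
  by rewrite ler_pM2l// (le_trans (ler_norm M))// lerDl.
by rewrite /r mulrDl divfK ?gt_eqF// mulrC.
Qed.
End LowerBound.

Theorem theorem2p5 (R : realType) (d : measure_display)
    (Omega : measurableType d)
    (mu : {sigma_finite_measure set Omega -> \bar R})
    (H : hilbertType R) (HO : Omega -> hilbertType R)
    (K : {linear H -> H}) (Lambda : forall w : Omega, {linear H -> HO w})
    (sepH : separable H) (bK : bounded_op K)
    (bLambda : forall w : Omega, bounded_op (Lambda w))
    (mLambda : forall f : H, strongly_measurable (fun w => Lambda w f)) :
  c_K_g_frame mu Lambda K <->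
  exists T : (forall w : Omega, HO w) -> H,
    [/\ weakly_defined mu Lambda T,
        bounded_Ltwo_op mu T
      & range K `<=` T @` Ltwo mu].
Proof.
split=> [[_ [A [B [A0 _ frame]]]]|[T [wT [_ [M bT]] KT]]].
  have LB f := (frame f).2.
  have [T [wT bT]] := synthesis_exists bLambda mLambda LB.
  exists T; split=> // _ [x _ <-].
  apply: (range_synthesis bLambda mLambda LB (C := hnorm x ^+ 2 / A) wT).
    move=> g; have := (frame g).1; rewrite int_hnorm; last exact: Ltwo_Lambda mLambda LB g.
    rewrite lee_fin => h.
    have -> : rdot (K x) g = rdot x (adjoint K g) by rewrite rdotC -rdot_adjoint// rdotC.
    rewrite mulrAC ler_pdivlMr//.
    apply: (@le_trans _ _ ((hnorm x * hnorm (adjoint K g)) ^+ 2 * A)).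
      rewrite ler_pM2r// -(real_normK (num_real (rdot _ _))).
      by rewrite ler_pXn2r ?nnegrE ?mulr_ge0 ?hnorm_ge0// rdot_le.
    by rewrite exprMn -mulrA ler_wpM2l ?sqr_ge0// mulrC.
  by rewrite divr_ge0 ?sqr_ge0 ?ltW.
have LB := bessel_of_bounded bLambda mLambda wT bT.
have LL := Ltwo_Lambda mLambda LB.
have [C C0 hC] := adjoint_le_of_range bLambda bK LL wT KT.
have A0 : 0 < (C ^+ 2)^-1 by rewrite invr_gt0 exprn_gt0.
split=> //; exists (C ^+ 2)^-1, (Num.max (C ^+ 2)^-1 (M ^+ 2)).
split=> // [|f]; first by rewrite le_max lexx.
split.
  rewrite int_hnorm// lee_fin -Ltwo_norm_sq mulrC ler_pdivrMr ?exprn_gt0//.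
  by rewrite mulrC -exprMn ler_pXn2r ?nnegrE ?hnorm_ge0// mulr_ge0 ?sqrtr_ge0 ?ltW.
apply: (le_trans (LB f)); rewrite lee_fin ler_wpM2r ?sqr_ge0//.
by rewrite le_max lexx orbT.
Qed.
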